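(* Let $t\in[0,1)$ and let $X$ be any Fréchet space in $\{\ell(p+),ces(p+),d(p+):1\le p<\infty\}$. (i) The generalized Cesàro operator $C_t$ maps $X$ into itself and $C_t\in\mathcal{L}(X)$. (ii) The right-shift operator $S$ maps $X$ into itself and belongs to $\mathcal{L}(X)$. (iii) The operator $R_t$ maps $X$ into itself and belongs to $\mathcal{L}(X)$, with the series $\sum_{n=0}^\infty t^nS^n$ being absolutely convergent in $\mathcal{L}_s(X)$. Moreover, $$C_t=D_\varphi R_t=\sum_{n=0}^\infty t^nD_\varphi S^n.$$
   Context: $\mathbb{N}_0=\{0,1,2,\dots\}$ and $\omega:=\mathbb{C}^{\mathbb{N}_0}$ with the topology of coordinatewise convergence. For $t\in[0,1]$, $C_tx:=\left(\frac{t^nx_0+t^{n-1}x_1+\dots+x_n}{n+1}\right)_{n\in\mathbb{N}_0}$ for $x\in\omega$ (with $0^0:=1$). On $\omega$ define $D_\varphi x:=\left(\frac{x_n}{n+1}\right)_{n\in\mathbb{N}_0}$ (where $\varphi:=(\frac1{n+1})_{n\in\mathbb{N}_0}$), the right-shift $Sx:=(0,x_0,x_1,\dots)$, and, for $t\in[0,1)$, $R_t:=\sum_{n=0}^\infty t^nS^n$, the series being absolutely convergent in $\mathcal{L}_s(\omega)$. All operators act on sequence spaces $X\subseteq\omega$ by restriction. Banach spaces: $\ell^q=\ell^q(\mathbb{N}_0)$ with its usual norm $\|\cdot\|_q$, $1\le q<\infty$; $ces(q):=\{x\in\omega: C_1|x|\in\ell^q\}$ with norm $\|x\|_{ces(q)}:=\|C_1|x|\,\|_q$,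 $1<q<\infty$, where $|x|=(|x_n|)_n$; $d_q:=\{x\in\ell^\infty:\hat x\in\ell^q\}$ with norm $\|x\|_{d_q}:=\|\hat x\|_q$, $1<q<\infty$, where $\hat x:=(\sup_{k\ge n}|x_k|)_{n\in\mathbb{N}_0}$. Fréchet spaces: for $1\le p<\infty$ and a strictly decreasing sequence $(p_k)_{k\in\mathbb{N}}\subseteq(p,\infty)$ with $p_k\downarrow p$, $\ell(p+):=\bigcap_k\ell^{p_k}$, $ces(p+):=\bigcap_k ces(p_k)$, $d(p+):=\bigcap_k d_{p_k}$, with the topology generated by the corresponding norms $\|\cdot\|_{p_k}$, $\|\cdot\|_{ces(p_k)}$, $\|\cdot\|_{d_{p_k}}$, $k\in\mathbb{N}$. $\mathcal{L}(X)$ is the space of continuous linear operators on $X$ and $\mathcal{L}_s(X)$ is $\mathcal{L}(X)$ with the topology of pointwise convergence on $X$ (strong operator topology). A series $\sum_nT_n$ is absolutely convergent in $\mathcal{L}_s(X)$ if it converges there and $\sum_nq(T_nx)<\infty$ for every $x\in X$ and every continuous seminorm $q$ on $X$. *)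

(* Defs.v *)
From HB Require Import structures.
From mathcomp Require Import all_boot all_order all_algebra.
From mathcomp Require Import complex.
From mathcomp Require Import all_classical all_reals all_analysis.

Set Implicit Arguments.
Unset Strict Implicit.
Unset Printing Implicit Defensive.

Import Order.TTheory GRing.Theory Num.Theory numFieldNormedType.Exports.

Local Open Scope classical_set_scope.
Local Open Scope complex_scope.
Local Open Scope ring_scope.

(* The real-valued modulus on R[i]; the library's `|z| is R[i]-valued. *)
Notation normc := (@ComplexField.Normc.normc _).

Definition omega (R : realType) := nat -> R[i].

HB.instance Definition _ (R : realType) :=
  GRing.Lmodule.copy (omega R) (nat -> R[i]^o).
HB.instance Definition _ (R : realType) :=
  Pointed.copy (omega R) (nat -> R[i]^o).
HB.instance Definition _ (R : realType) :=
  Topological.copy (omega R) {ptws nat -> R[i]^o}.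

Section operators.
Variable R : realType.
Implicit Types (t : R) (x : omega R).

Definition Cop t x : omega R :=
  fun n => (\sum_(i < n.+1) t%:C ^+ (n - i) * x i) / n.+1%:R.

Definition Dphi x : omega R := fun n => x n / n.+1%:R.

Definition Sop x : omega R := fun n => if n is m.+1 then x m else 0.

(* The sum of the series of t^n S^n in L_s(omega), whose topology is pointwise
   convergence; [lim] would take a default value if it diverged. *)
Definition Rop t x : omega R :=
  lim (series (fun n => t%:C ^+ n *: iter n Sop x) @ \oo).

End operators.

Section banach_spaces.
Variable R : realType.
Implicit Types (q : R) (x : omega R).

(* The usual norm of l^q, as an extended real, of a real sequence. *)
Definition lnorm q (f : nat -> R) : \bar R :=
  ('N[counting]_(q%:E) [EFin \o f])%E.

Definition abs_seq x : omega R := fun n => (normc (x n))%:C.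

Definition hat x (n : nat) : R := sup [set normc (x k) | k in [set k | (n <= k)%N]].

Definition bounded_seq x := exists M : R, forall n, normc (x n) <= M.

Inductive space_kind := Kell | Kces | Kd.

Definition bnorm (F : space_kind) q x : \bar R :=
  match F with
  | Kell => lnorm q (normc \o x)
  | Kces => lnorm q (normc \o Cop 1 (abs_seq x))
  | Kd => lnorm q (hat x)
  end.

(* In the last case boundedness is not redundant: [hat] is a real supremum,
   which has a default value on unbounded sets. *)
Definition bspace (F : space_kind) q : set (omega R) :=
  match F with
  | Kell | Kces => [set x | bnorm F q x < +oo]%E
  | Kd => [set x | bounded_seq x /\ (bnorm F q x < +oo)%E]
  end.

End banach_spaces.

Section bspace_closed.
Variable R : realType.
Implicit Types (q : R) (x y : omega R) (f g : nat -> R).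

Lemma normcD (a b : R[i]) : normc (a + b) <= normc a + normc b.
Proof. by rewrite -lecR rmorphD /=; exact: (ler_normD a b). Qed.

Lemma normc_ge0 (a : R[i]) : 0 <= normc a.
Proof. by rewrite -lecR; exact: (normr_ge0 a). Qed.

Lemma normc_real (r : R) : normc r%:C = `|r|.
Proof. by rewrite /= expr0n addr0 sqrtr_sqr. Qed.

Lemma le_lnorm q f g : 0 < q -> (forall n, 0 <= f n <= g n) ->
  (lnorm q f <= lnorm q g)%E.
Proof.
move=> q0 fg; rewrite /lnorm !Lnorm_counting//.
apply: gt0_ler_poweR; rewrite ?invr_ge0 ?(ltW q0)//.
- by rewrite in_itv/= leey andbT nneseries_ge0// => *; rewrite lee_fin powR_ge0.
- by rewrite in_itv/= leey andbT nneseries_ge0// => *; rewrite lee_fin powR_ge0.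
apply: lee_nneseries => [n _ _|n _]; first exact: poweR_ge0.
have /andP[f0 fgn] := fg n.
apply: gt0_ler_poweR; rewrite ?(ltW q0) ?in_itv/= ?leey ?lee_fin ?normr_ge0//.
by rewrite !ger0_norm// (le_trans f0).
Qed.

Lemma lnormD q f g : 1 <= q ->
  (lnorm q (fun n => (f n + g n)%R) <= lnorm q f + lnorm q g)%E.
Proof. by move=> q1; exact: minkowski_EFin. Qed.

Lemma lnormZ q f (c : R) : 0 < q -> 0 <= c -> (lnorm q f < +oo)%E ->
  (lnorm q (fun n => (c * f n)%R) < +oo)%E.
Proof.
move=> q0 c0; rewrite /lnorm !Lnorm_counting// => fq.
have {}fq : (\sum_(k <oo) (`|(EFin \o f) k| `^ q) < +oo)%E.
  by apply: lty_poweRy fq; rewrite gt_eqF ?invr_gt0.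
apply: poweR_lty.
under eq_eseriesr => k _.
  rewrite /= normrM (ger0_norm c0) powRM// EFinM. over.
rewrite nneseriesZl; last by move=> i _; rewrite lee_fin powR_ge0.
by rewrite lte_mul_pinfty ?lee_fin ?powR_ge0.
Qed.

Lemma lnorm_lin q f g h (c : R) : 1 <= q -> 0 <= c ->
  (forall n, 0 <= h n <= c * f n + g n) ->
  (lnorm q f < +oo)%E -> (lnorm q g < +oo)%E -> (lnorm q h < +oo)%E.
Proof.
move=> q1 c0 hfg fq gq; have q0 : 0 < q by rewrite (lt_le_trans ltr01).
apply: (le_lt_trans (le_lnorm q0 hfg)); apply: (le_lt_trans (lnormD _ _ q1)).
by rewrite lte_add_pinfty// lnormZ.
Qed.

Lemma lnorm0 q f : 0 < q -> (forall n, f n = 0) -> (lnorm q f < +oo)%E.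
Proof.
move=> q0 f0; rewrite /lnorm (_ : _ \o _ = cst 0%E).
  by rewrite Lnorm0 ?ltry// eqe gt_eqF.
by apply/funext => n /=; rewrite f0.
Qed.

Lemma normc_Cop_abs x n :
  normc (Cop 1 (abs_seq x) n) = (\sum_(i < n.+1) normc (x i)) / n.+1%:R.
Proof.
have -> : Cop 1 (abs_seq x) n = ((\sum_(i < n.+1) normc (x i)) / n.+1%:R)%:C.
  rewrite /Cop rmorphM fmorphV rmorph_nat rmorph_sum; congr (_ / _).
  by apply: eq_bigr => i _; rewrite rmorph1 expr1n mul1r.
by rewrite normc_real ger0_norm// divr_ge0// sumr_ge0// => i _; exact: normc_ge0.
Qed.

Lemma normc_lin (a : R[i]) x y n :
  normc ((a *: x + y) n) <= normc a * normc (x n) + normc (y n).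
Proof. by rewrite -ComplexField.Normc.normcM; exact: normcD. Qed.

Lemma bounded_lin (a : R[i]) x y :
  bounded_seq x -> bounded_seq y -> bounded_seq (a *: x + y).
Proof.
move=> [M xM] [N yN]; exists (normc a * M + N) => n.
apply: (le_trans (normc_lin _ _ _ _)).
by rewrite lerD// ler_wpM2l// normc_ge0.
Qed.

Lemma le_hat x n k : bounded_seq x -> (n <= k)%N -> normc (x k) <= hat x n.
Proof.
move=> [M xM] nk; apply: ub_le_sup; last by exists k.
by exists M => _ [j _ <-].
Qed.

Lemma hat_le x n (M : R) : (forall k, (n <= k)%N -> normc (x k) <= M) ->
  hat x n <= M.
Proof.
move=> xM; apply: ge_sup; first by exists (normc (x n)); exists n => /=.
by move=> _ [k /= nk <-]; exact: xM.
Qed.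

Lemma bspace_submod (F : space_kind) q : 1 <= q ->
  bspace F q 0 /\
  forall (a : R[i]) x y, bspace F q x -> bspace F q y -> bspace F q (a *: x + y).
Proof.
move=> q1; have q0 : 0 < q by rewrite (lt_le_trans ltr01).
have n0 (n : nat) : normc ((0 : omega R) n) = 0.
  by rewrite -[RHS](@ComplexField.Normc.normc0 R).
case: F => /=.
- split => [|a x y xq yq]; first exact: lnorm0.
  apply: (lnorm_lin q1 (normc_ge0 a) _ xq yq) => n.
  by rewrite normc_ge0 normc_lin.
- split => [|a x y xq yq].
    apply: lnorm0 => // n; apply: etrans (normc_Cop_abs _ _) _.
    by rewrite big1 ?mul0r// => i _; exact: n0.
  apply: (lnorm_lin q1 (normc_ge0 a) _ xq yq) => n /=.
  rewrite normc_ge0 /= !normc_Cop_abs mulrA -mulrDl.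
  rewrite ler_wpM2r ?invr_ge0// mulr_sumr -big_split /=.
  by apply: ler_sum => i _; exact: normc_lin.
- split => [|a x y [bx xq] [bY yq]].
    have b0 : bounded_seq (0 : omega R) by exists 0 => n; rewrite n0.
    split => //; apply: lnorm0 => // n; apply/eqP; rewrite eq_le.
    apply/andP; split; first by apply: hat_le => k _; rewrite n0.
    by rewrite -{1}(n0 n); apply: le_hat.
  have bxy := bounded_lin a bx bY.
  split => //; apply: (lnorm_lin q1 (normc_ge0 a) _ xq yq) => n.
  apply/andP; split.
    exact: le_trans (normc_ge0 _) (le_hat bxy (leqnn n)).
  apply: hat_le => k nk; apply: (le_trans (normc_lin _ _ _ _)).
  by rewrite lerD ?ler_wpM2l ?normc_ge0 ?le_hat.
Qed.

End bspace_closed.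

(* p together with a sequence strictly decreasing to p in (p, oo). *)
Record exponents (R : realType) := Exponents {
  expo : R ;
  expo_seq : nat -> R ;
  expo_ge1 : 1 <= expo ;
  expo_seq_gt : forall k, expo < expo_seq k ;
  expo_seq_decr : forall k, expo_seq k.+1 < expo_seq k ;
  expo_seq_cvg : expo_seq @ \oo --> expo }.

(* The spaces l(p+), ces(p+) and d(p+), according to F. *)
Section frechet_spaces.
Variables (R : realType) (F : space_kind) (e : exponents R).

Definition fspace_set : set (omega R) :=
  \bigcap_k bspace F (expo_seq e k).

Definition fspace_pred : {pred omega R} := fun x => x \in fspace_set.

Lemma fspace_submod_closed : submod_closed fspace_pred.
Proof.
have e1 k : 1 <= expo_seq e k.
  exact: le_trans (expo_ge1 e) (ltW (expo_seq_gt e k)).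
split=> [|a x y]; rewrite !unfold_in /fspace_pred ?inE.
  by move=> k _; have [] := bspace_submod F (e1 k).
move=> xP yP k _; have [_] := bspace_submod F (e1 k).
by apply; [exact: xP|exact: yP].
Qed.

HB.instance Definition _ :=
  GRing.isSubmodClosed.Build R[i] (omega R) fspace_pred fspace_submod_closed.

Record fspace := FSpace { fval :> omega R ; fvalP : fval \in fspace_pred }.

HB.instance Definition _ := [isSub for fval].
HB.instance Definition _ := [Choice of fspace by <:].
HB.instance Definition _ := [SubChoice_isSubLmodule of fspace by <:].

Definition fnorm (k : nat) (x : fspace) : \bar R := bnorm F (expo_seq e k) x.

(* The topology generated by the norms fnorm k; the finite intersections of
   balls that form a base are those over all k <= n. *)
Definition fspace_open (U : set fspace) : Prop :=
  forall x, U x -> exists n (eps : R), 0 < eps /\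
    forall y, (forall k, (k <= n)%N -> (fnorm k (y - x)%R < eps%:E)%E) -> U y.

Fact fspace_openT : fspace_open setT.
Proof. by move=> x _; exists 0%N, 1. Qed.

Fact fspace_openI : setI_closed fspace_open.
Proof.
move=> U V oU oV x [/oU[n [d [d0 dU]]] /oV[m [c [c0 cV]]]].
exists (maxn n m), (Num.min d c); split; first by rewrite lt_min d0.
move=> y yx; split.
- apply: dU => k kn; apply: lt_le_trans (yx k _) _.
    by rewrite leq_max kn.
  by rewrite lee_fin ge_min lexx.
- apply: cV => k kn; apply: lt_le_trans (yx k _) _.
    by rewrite leq_max kn orbT.
  by rewrite lee_fin ge_min lexx orbT.
Qed.

Fact fspace_open_bigU (I : Type) (f : I -> set fspace) :
  (forall i, fspace_open (f i)) -> fspace_open (\bigcup_i f i).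
Proof.
move=> of_ x [i _ fx]; have [n [d [d0 df]]] := of_ i x fx.
by exists n, d; split=> // y yx; exists i => //; exact: df.
Qed.

HB.instance Definition _ := isOpenTopological.Build fspace
  fspace_openT fspace_openI fspace_open_bigU.

Definition maps_into (T : omega R -> omega R) : Prop :=
  forall x, fspace_set x -> fspace_set (T x).

(* The restriction of T to the space; meaningful only under [maps_into T]. *)
Definition restr (T : omega R -> omega R) : fspace -> fspace :=
  fun x => insubd 0 (T x).

(* T maps the space into itself and its restriction is a continuous linear
   operator there. *)
Definition in_LX (T : omega R -> omega R) : Prop :=
  [/\ maps_into T, linear (restr T) & continuous (restr T)].

Definition continuous_seminorm (q : fspace -> R) : Prop :=
  [/\ forall x y, q (x + y) <= q x + q y,
      forall (a : R[i]) x, q (a *: x) = normc a * q x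
    & continuous q].

(* The series of the T n converges to A in L_s(X). *)
Definition Ls_series_cvg (T : nat -> omega R -> omega R) (A : omega R -> omega R)
  : Prop :=
  [/\ forall n, in_LX (T n), in_LX A
    & {ptws, series (fun n => restr (T n)) @ \oo --> restr A}].

Definition Ls_series_abs_cvg (T : nat -> omega R -> omega R)
    (A : omega R -> omega R) : Prop :=
  Ls_series_cvg T A /\
  forall (q : fspace -> R) (x : fspace), continuous_seminorm q ->
    (\sum_(0 <= n <oo) (q (restr (T n) x))%:E < +oo)%E.

End frechet_spaces.

Arguments in_LX {R} F e T.
Arguments Ls_series_cvg {R} F e T A.
Arguments Ls_series_abs_cvg {R} F e T A.

(* Main.v *)
Require Import Defs.
From HB Require Import structures.
From mathcomp Require Import all_boot all_order all_algebra.
From mathcomp Require Import complex.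
From mathcomp Require Import ring lra.
From mathcomp Require Import all_classical all_reals all_analysis.
Import Order.TTheory GRing.Theory Num.Theory numFieldNormedType.Exports.
Local Open Scope classical_set_scope.
Local Open Scope complex_scope.
Local Open Scope ring_scope.

(* Everything is controlled by one positive operator, the convolution G_s with
   the geometric sequence (s^n), 0 <= s < 1.  Since G_s f = f + s S(G_s f) and S
   is isometric on l^q, G_s is bounded on l^q with norm at most 1/(1-s).  If
   |y| <= M G_s|x| coordinatewise, then C_1|y| <= M G_s(C_1|x|) and
   hat y <= M/(1-s) G_s(hat x), so that in all three scales the norm of y is at
   most M/(1-s)^2 times the norm of x.  Choose s = (1+t)/2, so that t <= s^2.
   Then C_t, S, R_t = G_t, the terms t^n S^n and the remainders
   R_t - sum_(n<N) t^n S^n = t^N S^N R_t are all dominated in this way, the last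
   two with a factor s^n (resp. s^N), whence continuity and convergence. *)

Set Implicit Arguments.
Unset Strict Implicit.
Unset Printing Implicit Defensive.


(** * The l^q norm of real sequences: scaling, shift, truncation *)

Lemma lnormE (R : realType) (q : R) (f : nat -> R) : 0 < q ->
  lnorm q f = ((\sum_(k <oo) (`|f k| `^ q)%:E) `^ q^-1)%E.
Proof. by move=> q0; rewrite /lnorm Lnorm_counting. Qed.

Lemma lnorm_ge0 (R : realType) (q : R) (f : nat -> R) : (0 <= lnorm q f)%E.
Proof. exact: Lnorm_ge0. Qed.

Lemma lnorm_scale (R : realType) (q : R) (f : nat -> R) (c : R) :
  0 < q -> 0 <= c -> lnorm q (fun n => c * f n) = (c%:E * lnorm q f)%E.
Proof.
move=> q0 c0; rewrite !lnormE//.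
under eq_eseriesr do rewrite normrM (ger0_norm c0) powRM// EFinM.
rewrite nneseriesZl; last by move=> i _; rewrite lee_fin powR_ge0.
rewrite poweRM ?lee_fin ?powR_ge0//; last first.
  by apply: nneseries_ge0 => *; rewrite lee_fin powR_ge0.
by rewrite poweR_EFin -powRrM mulfV ?gt_eqF// powRr1.
Qed.

Definition rshift (R : realType) (f : nat -> R) (n : nat) : R :=
  if n is m.+1 then f m else 0.

Lemma lnorm_rshift (R : realType) (q : R) (f : nat -> R) : 0 < q ->
  lnorm q (rshift f) = lnorm q f.
Proof.
move=> q0; rewrite !lnormE//; congr poweR.
rewrite nneseries_recl//.
rewrite /= normr0 powR0 ?gt_eqF// add0e -(nneseries_addn 1%N) /=; last first.
  by move=> *; rewrite lee_fin powR_ge0.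
by apply: eq_eseriesr => i _; rewrite addn1.
Qed.

Definition cutoff (R : realType) (K : nat) (f : nat -> R) (n : nat) : R :=
  if (n < K)%N then f n else 0.

(** The first K terms of the series for [f] are those for [cutoff K f]. This allows a norm bound to
    be proved by induction on K, without knowing beforehand that the norm is finite. *)
Lemma lnorm_cutoff_le (R : realType) (q : R) (f : nat -> R) (M : \bar R) :
  0 < q -> (forall K, lnorm q (cutoff K f) <= M)%E -> (lnorm q f <= M)%E.
Proof.
move=> q0 fM; have M0 : (0 <= M)%E by exact: le_trans (lnorm_ge0 _ _) (fM 0%N).
have p0 (g : nat -> R) k : (0 <= (`|g k| `^ q)%:E)%E.
  by rewrite lee_fin powR_ge0.
have sum0 (g : nat -> R) : (0 <= \sum_(k <oo) (`|g k| `^ q)%:E)%E.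
  exact: nneseries_ge0.
have qK (x : \bar R) : (0 <= x)%E -> ((x `^ q^-1) `^ q = x)%E.
  by move=> x0; rewrite -poweRrM mulVf ?gt_eqF// poweRe1.
have qK' (x : \bar R) : (0 <= x)%E -> ((x `^ q) `^ q^-1 = x)%E.
  by move=> x0; rewrite -poweRrM mulfV ?gt_eqF// poweRe1.
rewrite lnormE// -[leRHS]qK'//.
apply: gt0_ler_poweR;
  rewrite ?invr_ge0 ?(ltW q0) ?in_itv/= ?leey ?sum0 ?poweR_ge0//.
apply: lime_le; first exact: is_cvg_nneseries.
apply: nearW => K.
apply: (@le_trans _ _ (lnorm q (cutoff K f) `^ q)%E); last first.
  by apply: gt0_ler_poweR; rewrite ?(ltW q0) ?in_itv/= ?leey ?lnorm_ge0 ?M0 ?fM.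
rewrite lnormE// qK//; apply: le_trans (nneseries_lim_ge K _); last by [].
rewrite !big_mkord; apply: lee_sum => i _.
by rewrite /cutoff ltn_ord.
Qed.

(** The operator G_s of the overview. The ring is arbitrary because it acts both on real sequences
    of moduli and, with a complex ratio, on [omega], where it is the closed form of R_t. *)
Definition geoconv (R : pzRingType) (s : R) (f : nat -> R) (n : nat) : R :=
  \sum_(i < n.+1) s ^+ (n - i) * f i.

Lemma geoconv0 (R : pzRingType) (s : R) (f : nat -> R) : geoconv s f 0 = f 0%N.
Proof. by rewrite /geoconv big_ord1 mul1r. Qed.

Lemma geoconvS (R : pzRingType) (s : R) (f : nat -> R) n :
  geoconv s f n.+1 = s * geoconv s f n + f n.+1.
Proof.
rewrite /geoconv big_ord_recr /= subnn expr0 mul1r mulr_sumr; congr (_ + _).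
by apply: eq_bigr => i _; rewrite mulrA -exprS subSn// -ltnS.
Qed.

(** * Boundedness of the geometric convolution on l^q *)

Section geoconv.
Variables (R : realType) (s : R).
Hypotheses (s0 : 0 <= s) (s1 : s < 1).
Implicit Types f g : nat -> R.

Lemma geoconv_ge0 f n : (forall k, 0 <= f k) -> 0 <= geoconv s f n.
Proof. by move=> f0; apply: sumr_ge0 => i _; rewrite mulr_ge0// exprn_ge0. Qed.

(** Taking partial sums is convolution with the constant sequence 1, and convolutions commute. *)
Lemma sum_geoconv f n :
  \sum_(j < n.+1) geoconv s f j = geoconv s (fun k => \sum_(j < k.+1) f j) n.
Proof.
elim: n => [|n IH]; first by rewrite geoconv0 !big_ord1 geoconv0.
rewrite geoconvS -IH [RHS]addrC; elim: n.+1 => [|m IHm].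
  by rewrite !big_ord1 big_ord0 geoconv0 mulr0 addr0.
by rewrite [LHS]big_ord_recr /= {1}IHm geoconvS !big_ord_recr /=; ring.
Qed.

(** The norms a_K of the cutoffs of G_s f satisfy a_(K+1) <= s a_K + a, where a is the norm of f,
    because cutting off at K+1 after a shift is shifting the cutoff at K. The bound a/(1-s) is the
    fixed point of this recursion. *)
Lemma lnorm_geoconv (q : R) f : 1 <= q -> (forall n, 0 <= f n) ->
  (lnorm q (geoconv s f) <= (1 - s)^-1%:E * lnorm q f)%E.
Proof.
move=> q1 f0; have q0 : 0 < q by rewrite (lt_le_trans ltr01).
have s10 : 0 < 1 - s by rewrite subr_gt0.
have c0 n := geoconv_ge0 n f0.
apply: lnorm_cutoff_le => //; elim=> [|K IH].
  (* Writing the empty cutoff as a multiple of [f] reduces the base case to comparing the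
     coefficients 0 and 1/(1-s), also when the norm of [f] is infinite. *)
  have -> : cutoff 0 (geoconv s f) = fun n => 0 * f n.
    by apply/funext => n; rewrite mul0r.
  rewrite lnorm_scale// lee_wpmul2r ?lnorm_ge0// lee_fin invr_ge0 ltW//.
apply: (@le_trans _ _
    (s%:E * ((1 - s)^-1%:E * lnorm q f) + lnorm q f)%E); last first.
  case: (lnorm q f) (lnorm_ge0 q f) => [r _| _ |//].
    rewrite lee_fin -subr_ge0 [X in 0 <= X](_ : _ = 0)//.
    by field; rewrite gt_eqF.
  by rewrite [leRHS]gt0_muley ?lte_fin ?invr_gt0// leey.
apply: le_trans (leeD (lee_wpmul2l _ IH) (lexx _)); last by rewrite lee_fin.
rewrite -(lnorm_rshift (cutoff K _) q0) -lnorm_scale//.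
apply: le_trans (lnormD _ _ q1); apply: le_lnorm => // -[|n] /=.
  by rewrite /cutoff/= mulr0 add0r geoconv0 lexx f0.
rewrite /cutoff ltnS; case: ifP => _; first by rewrite c0 geoconvS lexx.
by rewrite lexx mulr0 add0r f0.
Qed.

End geoconv.


(** * Domination by G_s and its effect on the three norms *)

Section geodominated.
Variables (R : realType) (s : R).
Hypotheses (s0 : 0 <= s) (s1 : s < 1).
Implicit Types (f g : nat -> R) (x y : omega R).

Let s10 : 0 < 1 - s. Proof. by rewrite subr_gt0. Qed.

Let inv_ge1 : 1 <= (1 - s)^-1.
Proof. by rewrite invf_ge1// lerBlDr lerDl. Qed.

Lemma geoconv_le f g n : (forall k, (k <= n)%N -> f k <= g k) ->
  geoconv s f n <= geoconv s g n.
Proof.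
move=> fg; apply: ler_sum => i _; rewrite ler_wpM2l ?exprn_ge0//.
by apply: fg; rewrite -ltnS.
Qed.

Lemma geoconv_scale (c : R) f n :
  geoconv s (fun k => c * f k) n = c * geoconv s f n.
Proof.
by rewrite /geoconv mulr_sumr; apply: eq_bigr => i _; rewrite mulrCA.
Qed.

Lemma geoconv_le_bound (B : R) f n : 0 <= B -> (forall k, f k <= B) ->
  geoconv s f n <= (1 - s)^-1 * B.
Proof.
move=> B0 fB; elim: n => [|n IH].
  by rewrite geoconv0 (le_trans (fB _))// ler_peMl.
rewrite geoconvS; apply: (@le_trans _ _ (s * ((1 - s)^-1 * B) + B)).
  by rewrite lerD// ler_wpM2l.
rewrite -subr_ge0 [X in 0 <= X](_ : _ = 0)//.
by field; rewrite gt_eqF.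
Qed.

(** The real sequence whose l^q norm is the norm of [x], so that the three scales can be treated
    together. *)
Definition modulus (F : space_kind) x : nat -> R :=
  match F with
  | Kell => normc \o x
  | Kces => normc \o Cop 1 (abs_seq x)
  | Kd => hat x
  end.

Lemma bnormE F (q : R) x : bnorm F q x = lnorm q (modulus F x).
Proof. by case: F. Qed.

Lemma bspaceE F (q : R) x :
  bspace F q x <-> (F = Kd -> bounded_seq x) /\ (bnorm F q x < +oo)%E.
Proof. by case: F; split=> //= -[]// b ->; split => //; exact: b. Qed.

Lemma modulus_ge0 F x n : (F = Kd -> bounded_seq x) -> 0 <= modulus F x n.
Proof.
case: F => /= bx; try exact: normc_ge0.
exact: le_trans (normc_ge0 _) (le_hat (bx erefl) (leqnn n)).
Qed.

Definition geodominated (M : R) x y :=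
  forall n, normc (y n) <= M * geoconv s (normc \o x) n.

Lemma geodominated_bounded (M : R) x y : 0 <= M -> geodominated M x y ->
  bounded_seq x -> bounded_seq y.
Proof.
move=> M0 xy [B xB]; have B0 : 0 <= B := le_trans (normc_ge0 _) (xB 0%N).
exists (M * ((1 - s)^-1 * B)) => n; apply: le_trans (xy n) _.
by rewrite ler_wpM2l// geoconv_le_bound.
Qed.

(** Lower both indices together, using the recursion for G_s, until n is 0. Only there is the factor
    1/(1-s) spent, through the uniform bound of |x| by its supremum [hat x 0]. *)
Lemma geoconv_le_hat x n k : bounded_seq x -> (n <= k)%N ->
  geoconv s (normc \o x) k <= (1 - s)^-1 * geoconv s (hat x) n.
Proof.
move=> bx; elim: n k => [|n IH] [|k]// nk.
- rewrite !geoconv0 /=; apply: (@le_trans _ _ (hat x 0)); first exact: le_hat.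
  by rewrite ler_peMl// (le_trans (normc_ge0 (x 0%N)) (le_hat bx _)).
- rewrite geoconv0; apply: geoconv_le_bound => [|j]; last exact: le_hat.
  by rewrite (le_trans (normc_ge0 (x 0%N)) (le_hat bx _)).
- rewrite !geoconvS mulrDr lerD//.
    by rewrite mulrCA ler_wpM2l// IH.
  apply: (@le_trans _ _ (hat x n.+1)); first exact: le_hat.
  by rewrite ler_peMl// (le_trans (normc_ge0 (x n.+1)) (le_hat bx _)).
Qed.

(** The three scales differ only here. For l^q this is the domination itself; for ces(q), partial
    sums commute with G_s; for d_q, [geoconv_le_hat] applies, the only case that spends 1/(1-s). *)
Lemma geodominated_modulus F (M : R) x y n : 0 <= M ->
  (F = Kd -> bounded_seq x) -> geodominated M x y ->
  modulus F y n <= M * (1 - s)^-1 * geoconv s (modulus F x) n.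
Proof.
move=> M0 bx xy.
have weak (a b : R) : 0 <= b -> a <= M * b -> a <= M * (1 - s)^-1 * b.
  by move=> b0 ab; rewrite (le_trans ab)// ler_wpM2r// ler_peMr.
have c0 : 0 <= geoconv s (modulus F x) n.
  by apply: geoconv_ge0 => // k; exact: modulus_ge0.
case: F bx c0 => bx c0.
- by apply: weak => //; exact: xy.
- apply: weak => //; rewrite [leLHS]normc_Cop_abs.
  rewrite ler_pdivrMr ?ltr0Sn//.
  apply: (@le_trans _ _ (\sum_(i < n.+1) M * geoconv s (normc \o x) i)).
    by apply: ler_sum => i _; exact: xy.
  rewrite -mulr_sumr sum_geoconv -mulrA ler_wpM2l// mulrC -geoconv_scale.
  (* Dividing by n+1 instead of k+1 only makes the averages smaller, since k <= n. *)
  apply: geoconv_le => k kn; rewrite [X in _ * X]normc_Cop_abs.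
  rewrite mulrCA ler_peMr//; first by apply: sumr_ge0 => i _; exact: normc_ge0.
  by rewrite ler_pdivlMr ?ltr0Sn// mul1r ler_nat.
- apply: hat_le => k nk; apply: le_trans (xy k) _.
  by rewrite -mulrA ler_wpM2l//; apply: geoconv_le_hat nk; exact: bx.
Qed.

(** One factor 1/(1-s) comes from passing to [modulus], the other from the norm of G_s on l^q. *)
Lemma geodominated_bspace F (q M : R) x y : 1 <= q -> 0 <= M ->
  bspace F q x -> geodominated M x y ->
  bspace F q y /\
  (bnorm F q y <= (M * (1 - s)^-1 ^+ 2)%:E * bnorm F q x)%E.
Proof.
move=> q1 M0 /bspaceE[bx xq] xy; have q0 : 0 < q by rewrite (lt_le_trans ltr01).
have byF : F = Kd -> bounded_seq y.
  by move=> /bx; exact: geodominated_bounded xy.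
have c0 : 0 <= (1 - s)^-1 by rewrite (le_trans ler01).
have le_xy : (bnorm F q y <= (M * (1 - s)^-1 ^+ 2)%:E * bnorm F q x)%E.
  rewrite !bnormE expr2 mulrA EFinM -muleA.
  apply: (@le_trans _ _ 
    ((M * (1 - s)^-1)%:E * lnorm q (geoconv s (modulus F x)))%E).
    rewrite -lnorm_scale ?mulr_ge0//; apply: le_lnorm => // n.
    by rewrite modulus_ge0// geodominated_modulus.
  rewrite lee_wpmul2l ?lee_fin ?mulr_ge0// lnorm_geoconv// => n.
  exact: modulus_ge0.
split=> //; apply/bspaceE; split=> //; apply: le_lt_trans le_xy _.
by rewrite lte_mul_pinfty// lee_fin mulr_ge0// exprn_ge0.
Qed.

End geodominated.


(** * Algebra of the shift on [omega] and identification of R_t *)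

Section shift.
Variable R : realType.
Implicit Types (x y : omega R) (a : R[i]).

Lemma Sop_linear : linear (@Sop R).
Proof.
move=> a x y; apply/funext => -[|n] //.
by rewrite /= [RHS](_ : _ = a * 0 + 0)// mulr0 addr0.
Qed.

Lemma iter_Sop_linear N : linear (iter N (@Sop R)).
Proof. by elim: N => [|N IH] a x y //; rewrite !iterS IH Sop_linear. Qed.

Lemma Dphi_linear : linear (@Dphi R).
Proof. by move=> a x y; apply/funext => n; rewrite /Dphi mulrDl -mulrA. Qed.

Lemma iter_Sop N x k :
  iter N (@Sop R) x k = if (N <= k)%N then x (k - N)%N else 0.
Proof.
elim: N k => [|N IH] [|k]//.
by rewrite iterS /= IH ltnS subSS.
Qed.

Lemma geoconv_linear a : linear (geoconv a : omega R -> omega R).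
Proof.
move=> b x y; apply/funext => n.
rewrite /geoconv /= [RHS](_ : _ = b * \sum_(i < n.+1) a ^+ (n - i) * x i
  + \sum_(i < n.+1) a ^+ (n - i) * y i)//.
rewrite mulr_sumr -big_split /=; apply: eq_bigr => i _.
by rewrite [X in _ * X](_ : _ = b * x i + y i)// mulrDr mulrCA.
Qed.

(** The resolvent identity: G_a is a right inverse of I - aS. *)
Lemma geoconv_shift a x : geoconv a x = x + a *: Sop (geoconv a x) :> omega R.
Proof.
apply/funext => -[|n].
  by rewrite geoconv0 [RHS](_ : _ = x 0%N + a * 0)// mulr0 addr0.
by rewrite geoconvS addrC.
Qed.

(** The resolvent identity iterated N times. Being exact, it gives convergence both in [omega] and
    in the Fréchet spaces. *)
Lemma geoconv_remainder a x N :
  geoconv a x - \sum_(0 <= m < N) a ^+ m *: iter m (@Sop R) x =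
  a ^+ N *: iter N (@Sop R) (geoconv a x) :> omega R.
Proof.
elim: N => [|N IH]; first by rewrite big_nil subr0 expr0 scale1r.
rewrite big_nat_recr //= opprD addrA IH -scalerBr exprSr -scalerA.
congr (_ *: _).
by rewrite {1}geoconv_shift [x + _]addrC iter_Sop_linear addrK -iterSr.
Qed.

(** Every coordinate of the partial sums is eventually constant: the remainder carries S^N, which
    vanishes at coordinates k < N. No condition on the size of [a] is involved. *)
Lemma series_iter_Sop_cvg a x :
  series (fun n => a ^+ n *: iter n (@Sop R) x) @ \oo -->
  (geoconv a x : omega R).
Proof.
apply/cvg_sup => k U [V [[W oW <-] Wk WU]].
apply: (filterS WU); rewrite nbhs_simpl /=.
exists k.+1 => // N /= kN; rewrite (_ : series _ N k = geoconv a x k)//.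
have /(congr1 (fun y : omega R => y k)) := geoconv_remainder a x N.
rewrite [RHS](_ : _ = a ^+ N * iter N (@Sop R) (geoconv a x) k)//.
rewrite iter_Sop leqNgt kN mulr0 => /eqP; rewrite subr_eq0 => /eqP ->.
by [].
Qed.

(** [Rop] is defined by [lim], so its value is determined by uniqueness of limits in the Hausdorff
    product space. *)
Lemma RopE (t : R) x : Rop t x = geoconv t%:C x.
Proof.
apply: cvg_lim; last exact: series_iter_Sop_cvg.
apply: (@hausdorff_product nat (fun=> R[i]^o)) => _; exact: norm_hausdorff.
Qed.

End shift.


(** * Domination of the concrete operators by G_s *)

Section geodominated_operators.
Variables (R : realType) (s : R).
Hypotheses (s0 : 0 <= s) (s1 : s < 1).
Implicit Types (x y : omega R) (t M : R).

Lemma normcM (a b : R[i]) : normc (a * b) = normc a * normc b.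
Proof. exact: ComplexField.Normc.normcM. Qed.

Lemma normcN (a : R[i]) : normc (- a) = normc a.
Proof. by case: a => a b /=; rewrite !sqrrN. Qed.

Lemma normc_realX t n : 0 <= t -> normc (t%:C ^+ n) = t ^+ n.
Proof.
by move=> t0; rewrite -rmorphXn normc_real ger0_norm// exprn_ge0.
Qed.

Lemma normc_sum n (f : 'I_n -> R[i]) :
  normc (\sum_(i < n) f i) <= \sum_(i < n) normc (f i).
Proof.
elim/big_ind2 : _ => [|a b c d ab cd|//].
- by rewrite ComplexField.Normc.normc0.
- exact: le_trans (normcD _ _) (lerD ab cd).
Qed.

Lemma geoconv_normc_ge0 x n : 0 <= geoconv s (normc \o x) n.
Proof. by apply: geoconv_ge0 => // k; exact: normc_ge0. Qed.

Lemma le_geoconv x n : normc (x n) <= geoconv s (normc \o x) n.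
Proof.
case: n => [|n]; first by rewrite geoconv0.
by rewrite geoconvS lerDr mulr_ge0// geoconv_normc_ge0.
Qed.

(** Each use of the recursion drops one nonnegative term |x_n|. *)
Lemma geoconv_shift_le x N n : (N <= n)%N ->
  s ^+ N * geoconv s (normc \o x) (n - N) <= geoconv s (normc \o x) n.
Proof.
elim: N n => [|N IH] [|n]//; rewrite ?subn0 ?expr0 ?mul1r// subSS => Nn.
rewrite geoconvS exprS -mulrA; apply: le_trans (ler_wpM2l s0 (IH n Nn)) _.
by rewrite lerDl normc_ge0.
Qed.

Lemma geodominated_id x : geodominated s 1 x x.
Proof. by move=> n; rewrite mul1r le_geoconv. Qed.

Lemma geodominated_scale M (a : R[i]) x y :
  geodominated s M x y -> geodominated s (normc a * M) x (a *: y).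
Proof. by move=> xy n; rewrite normcM -mulrA ler_wpM2l ?normc_ge0. Qed.

Lemma geodominated_Dphi M x y :
  geodominated s M x y -> geodominated s M x (Dphi y).
Proof.
move=> xy n; apply: le_trans (xy n); rewrite /Dphi normcM.
rewrite ler_piMr ?normc_ge0//.
have -> : (n.+1%:R : R[i])^-1 = (n.+1%:R^-1)%:C by rewrite fmorphV rmorph_nat.
by rewrite normc_real ger0_norm ?invr_ge0// invf_le1 ?ltr0Sn// ler1n.
Qed.

Lemma geodominated_geoconv t x : 0 <= t -> t <= s ->
  geodominated s 1 x (geoconv t%:C x).
Proof.
move=> t0 ts n; rewrite mul1r; apply: le_trans (normc_sum _) _.
apply: ler_sum => i _; rewrite normcM normc_realX// ler_wpM2r ?normc_ge0//.
exact: lerXn2r.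
Qed.

Lemma geodominated_Sop x : 0 < s -> geodominated s s^-1 x (Sop x).
Proof.
move=> s_gt0 [|n]; rewrite [Sop x _]/=.
  by rewrite ComplexField.Normc.normc0 mulr_ge0 ?invr_ge0 ?geoconv_normc_ge0.
rewrite ler_pdivlMl//; apply: le_trans (ler_wpM2l s0 (le_geoconv x n)) _.
by rewrite geoconvS lerDl normc_ge0.
Qed.

(* Since t <= s^2, one factor s^N is left over after absorbing the shift. *)
Lemma geodominated_iter_Sop t M N x y : 0 <= t -> t <= s ^+ 2 -> 0 <= M ->
  geodominated s M x y ->
  geodominated s (s ^+ N * M) x (t%:C ^+ N *: iter N (@Sop R) y).
Proof.
move=> t0 ts M0 xy n; rewrite normcM normc_realX// iter_Sop.
case: ifPn => Nn; last first.
  by rewrite ComplexField.Normc.normc0 mulr0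
    !mulr_ge0 ?exprn_ge0 ?geoconv_normc_ge0.
apply: (@le_trans _ _ ((s ^+ 2) ^+ N * (M * geoconv s (normc \o x) (n - N)))).
  by rewrite ler_pM ?exprn_ge0 ?normc_ge0 ?lerXn2r ?nnegrE ?exprn_ge0.
rewrite -exprM mulnC exprM expr2 -!mulrA ler_wpM2l ?exprn_ge0// mulrCA.
by rewrite ler_wpM2l// geoconv_shift_le.
Qed.

End geodominated_operators.

(** The pointwise topology is the supremum of the initial topologies of the evaluations, so one
    argument can be tested at a time. *)
Lemma ptws_cvg (U I : Type) (V : topologicalType) (G : set_system I)
    (u : I -> U -> V) (f : U -> V) : Filter G ->
  (forall z, u ^~ z @ G --> f z) -> {ptws, u @ G --> f}.
Proof.
move=> GF uf; apply/cvg_sup => z A [B [[W oW <-] Wf BA]].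
apply: (filterS BA); apply: uf; exact: open_nbhs_nbhs.
Qed.

(** * Continuity and convergence in the Fréchet spaces *)

Section frechet.
Variables (R : realType) (F : space_kind) (e : exponents R) (s : R).
Hypotheses (s0 : 0 <= s) (s1 : s < 1).
Implicit Types (T A : omega R -> omega R).

Lemma fspace_openE (U : set (fspace F e)) : open U = fspace_open U.
Proof. by []. Qed.

Lemma expo_seq_ge1 k : 1 <= expo_seq e k.
Proof. exact: le_trans (expo_ge1 e) (ltW (expo_seq_gt e k)). Qed.

Lemma fspaceP (x : fspace F e) k : bspace F (expo_seq e k) x.
Proof. by have := fvalP x; rewrite unfold_in inE => /(_ k I). Qed.

Lemma fnorm_fin (x : fspace F e) k : fnorm k x \is a fin_num.
Proof.
rewrite ge0_fin_numE; last by rewrite /fnorm bnormE lnorm_ge0.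
by have /bspaceE[] := fspaceP x k.
Qed.

(** The ratio [r] is independent of [s]: with r = 0, where G_r is the identity, this also bounds the
    norms of scalar multiples. *)
Lemma fnorm_dominated (r M : R) (x z : fspace F e) k :
  0 <= r -> r < 1 -> 0 <= M ->
  geodominated r M x z ->
  (fnorm k z <= (M * (1 - r)^-1 ^+ 2)%:E * fnorm k x)%E.
Proof.
move=> r0 r1 M0 xz.
by have [] := geodominated_bspace r0 r1 (expo_seq_ge1 k) M0 (fspaceP x k) xz.
Qed.

Lemma maps_into_dominated T M : 0 <= M ->
  (forall x, geodominated s M x (T x)) ->
  maps_into F e T.
Proof.
move=> M0 xT x xF k _.
by have [] := geodominated_bspace s0 s1 (expo_seq_ge1 k) M0 (xF k I) (xT x).
Qed.

Lemma restrE T (x : fspace F e) : maps_into F e T -> fval (restr T x) = T x.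
Proof.
move=> Tm; rewrite /restr [LHS]insubdK//.
by rewrite unfold_in inE; apply: Tm => k _; exact: fspaceP.
Qed.

(** Each norm of T x is at most a constant, the same for all k, times the same norm of x. *)
Lemma in_LX_dominated T M : linear T -> 0 <= M ->
  (forall x, geodominated s M x (T x)) -> in_LX F e T.
Proof.
move=> Tl M0 xT; have Tm := maps_into_dominated M0 xT.
have Trl : linear (restr T : fspace F e -> fspace F e).
  move=> a x y; apply: val_inj.
  by rewrite linearP /= !restrE//; exact: Tl.
split=> //; apply/continuousP => U; rewrite !fspace_openE => oU x Ux.
have [n [eps [eps0 epsU]]] := oU _ Ux.
pose c := M * (1 - s)^-1 ^+ 2.
have c0 : 0 <= c by rewrite mulr_ge0// exprn_ge0// invr_ge0 subr_ge0 ltW.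
(* Dividing by c + 1 avoids the case c = 0. *)
exists n, (eps / (c + 1)); split; first by rewrite divr_gt0// ltr_wpDl.
move=> y yx; apply: epsU => k kn.
have -> : restr T y - restr T x = restr T (y - x).
  by rewrite -scaleN1r addrC -Trl scaleN1r addrC.
apply: (@le_lt_trans _ _ (c%:E * fnorm k (y - x)%R)%E).
  by apply: fnorm_dominated => //; rewrite restrE.
move: (yx k kn) (fnorm_fin (y - x) k); case: fnorm => // r.
rewrite !lte_fin ltr_pdivlMr ?ltr_wpDl// => rc _.
have [r0|r0] := leP 0 r; last first.
  by rewrite (le_lt_trans _ eps0)// mulr_ge0_le0// ltW.
by apply: le_lt_trans rc; rewrite mulrC ler_wpM2l// lerDl.
Qed.

Lemma fspace_cvg (u : nat -> fspace F e) (l : fspace F e) :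
  (forall k eps, 0 < eps ->
    \forall N \near \oo, (fnorm k (u N - l)%R < eps%:E)%E) ->
  u @ \oo --> l.
Proof.
move=> ul U; rewrite nbhsE => -[B [oB Bl] BU].
have [n [eps [eps0 epsB]]] := oB _ Bl.
have : \forall N \near \oo,
    forall k : 'I_n.+1, (fnorm k (u N - l)%R < eps%:E)%E.
  by apply: filter_forall => k; exact: ul.
apply: filterS => N uN; apply/BU/epsB => k kn.
by have := uN (Ordinal (kn : (k < n.+1)%N)).
Qed.

Lemma fval_sum (u : nat -> fspace F e) N :
  fval (\sum_(0 <= n < N) u n) = \sum_(0 <= n < N) fval (u n).
Proof. exact: (raddf_sum (\val : fspace F e -> omega R)). Qed.

(** The k-th norm of the remainder at x is at most a constant, depending on x and k, times s^N. *)
Lemma Ls_series_cvg_dominated (T : nat -> omega R -> omega R) A M :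
  (forall n, in_LX F e (T n)) -> in_LX F e A -> 0 <= M ->
  (forall x N, geodominated s (s ^+ N * M) x (A x - \sum_(0 <= n < N) T n x)) ->
  Ls_series_cvg F e T A.
Proof.
move=> Tn LA M0 rem; split=> //.
apply: ptws_cvg => x; apply: fspace_cvg => k eps eps0.
pose c := M * (1 - s)^-1 ^+ 2 * fine (fnorm k x).
have c0 : 0 <= c.
  rewrite !mulr_ge0// ?invr_ge0 ?subr_ge0 ?(ltW s1)// fine_ge0//.
  by rewrite /fnorm bnormE lnorm_ge0.
have : geometric c s @ \oo --> 0 by apply: cvg_geometric; rewrite ger0_norm.
move=> /cvgr0_norm_lt /(_ _ eps0); apply: filterS => N /= cN.
have [Am _ _] := LA.
set z := (_ - _).
(* [z] is partial sum minus limit, hence minus the remainder; moduli ignore the sign. *)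
have zE : - fval z = A x - \sum_(0 <= n < N) T n x.
  rewrite /z /series /= fct_sumE.
  rewrite opprB restrE// fval_sum.
  by congr (_ - _); apply: eq_bigr => n _; rewrite restrE//; have [] := Tn n.
have xz : geodominated s (s ^+ N * M) x z.
  move=> n; apply: le_trans (rem x N n); rewrite -zE.
  by rewrite [X in _ <= normc X](_ : _ = - fval z n)// normcN.
apply: le_lt_trans (fnorm_dominated k s0 s1 _ xz) _.
  by rewrite mulr_ge0// exprn_ge0.
rewrite -(fineK (fnorm_fin x k)) lte_fin.
apply: le_lt_trans cN; apply: le_trans (ler_norm _).
by rewrite [leLHS](_ : _ = c * s ^+ N)// /c; ring.
Qed.

End frechet.

Arguments in_LX_dominated {R F e s} s0 s1 {T M}.

(** * Continuous seminorms and the defining norms *)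

Section seminorms.
Variables (R : realType) (F : space_kind) (e : exponents R).

(** 0 = q(x + (-x)) <= 2 q(x). *)
Lemma continuous_seminorm_ge0 (q : fspace F e -> R) x :
  continuous_seminorm q -> 0 <= q x.
Proof.
move=> [qD qZ _]; have q0 : q 0 = 0.
  by rewrite -(scale0r 0) qZ ComplexField.Normc.normc0 mul0r.
have := qD x (- x); rewrite subrr q0 -scaleN1r qZ.
by rewrite normcN ComplexField.Normc.normc1 mul1r -mulr2n pmulrn_lge0.
Qed.

(** Finitely many norms control q, by homogeneity from a neighbourhood of 0 on which |q| < 1. Taking
    any positive upper bound B of these norms avoids division by zero when they vanish at x. *)
Lemma continuous_seminorm_bound (q : fspace F e -> R) : continuous_seminorm q ->
  exists n D, 0 < D /\ forall x B, 0 < B ->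
    (forall k, (k <= n)%N -> (fnorm k x <= B%:E)%E) -> q x <= D * B.
Proof.
move=> [qD qZ qC]; have q0 : q 0 = 0.
  by rewrite -(scale0r 0) qZ ComplexField.Normc.normc0 mul0r.
have : q @ nbhs (0 : fspace F e) --> (0 : R) by rewrite -q0; exact: qC.
move=> /cvgr0_norm_lt /(_ _ ltr01).
rewrite /= nbhsE => -[U [oU U0] Uq].
have [n [eps [eps0 epsU]]] := oU _ U0.
exists n, (2 / eps); split; first by rewrite divr_gt0.
(* Scaling by [a] brings the norms down to at most eps/2, strictly inside the neighbourhood; undoing
   it yields 2B/eps. *)
move=> x B B0 xB; set a := eps / (2 * B).
have a0 : 0 < a by rewrite divr_gt0// mulr_gt0.
have : `|q (a%:C *: x)| < 1.
  apply: Uq; apply: epsU => k kn; rewrite subr0.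
  have xa : geodominated 0 a x (a%:C *: x).
    by have := geodominated_scale a%:C (geodominated_id (lexx 0) x);
      rewrite normc_real gtr0_norm// mulr1.
  apply: le_lt_trans (fnorm_dominated k (lexx 0) ltr01 (ltW a0) xa) _.
  rewrite subr0 invr1 expr1n mulr1.
  apply: le_lt_trans (lee_wpmul2l _ (xB k kn)) _; first by rewrite lee_fin ltW.
  rewrite lte_fin /a invfM mulrA mulfVK ?gt_eqF// ltr_pdivrMr//.
  by rewrite ltr_pMr// ltr1n.
move=> /ltr_normlW; rewrite qZ normc_real gtr0_norm// /a.
rewrite mulrAC ltr_pdivrMr ?mulr_gt0// mul1r => /ltW.
by rewrite mulrAC ler_pdivlMr// mulrC.
Qed.

End seminorms.


(** * Absolute convergence by comparison with a geometric series *)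

Section absolute_convergence.
Variables (R : realType) (F : space_kind) (e : exponents R) (s M : R).
Hypotheses (s_gt0 : 0 < s) (s1 : s < 1) (M0 : 0 <= M).

Lemma sum_expr_le n : \sum_(0 <= i < n) s ^+ i <= (1 - s)^-1.
Proof.
have s10 : 0 < 1 - s by rewrite subr_gt0.
suff -> : \sum_(0 <= i < n) s ^+ i = (1 - s ^+ n) / (1 - s).
  by rewrite ler_piMl ?invr_ge0 ?(ltW s10)// gerBl exprn_ge0// ltW.
elim: n => [|n IH]; first by rewrite big_nil expr0 subrr mul0r.
by rewrite big_nat_recr //= IH exprS; field; rewrite gt_eqF.
Qed.

Lemma seminorm_series_lty (T : nat -> omega R -> omega R)
    (q : fspace F e -> R) (x : fspace F e) :
  (forall n, maps_into F e (T n)) ->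
  (forall n y, geodominated s (s ^+ n * M) y (T n y)) ->
  continuous_seminorm q ->
  (\sum_(0 <= n <oo) (q (restr (T n) x))%:E < +oo)%E.
Proof.
move=> Tm Td qc; have [m [D [D0 qD]]] := continuous_seminorm_bound qc.
pose c := M * (1 - s)^-1 ^+ 2.
have c0 : 0 <= c by rewrite mulr_ge0// exprn_ge0// invr_ge0 subr_ge0 ltW.
have fine0 k : 0 <= fine (fnorm k x).
  by rewrite fine_ge0// /fnorm bnormE lnorm_ge0.
(* The sum dominates each of the norms k <= m at once; the added 1 makes B positive, as
   [continuous_seminorm_bound] requires. *)
pose B := 1 + c * \sum_(k < m.+1) fine (fnorm k x).
have B0 : 0 < B by rewrite ltr_wpDr// mulr_ge0// sumr_ge0.
have qT n : q (restr (T n) x) <= D * (s ^+ n * B).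
  apply: qD => [|k km]; first by rewrite mulr_gt0// exprn_gt0.
  apply: le_trans (fnorm_dominated k (ltW s_gt0) s1 _
    (_ : geodominated s (s ^+ n * M) x _)) _.
  - by rewrite mulr_ge0// exprn_ge0// ltW.
  - by rewrite restrE//; exact: Td.
  rewrite -(fineK (fnorm_fin x k)) -[s ^+ n * M * _]mulrA -/c -EFinM lee_fin.
  rewrite -mulrA ler_wpM2l ?exprn_ge0 ?(ltW s_gt0)//.
  apply: (@le_trans _ _ (c * \sum_(k < m.+1) fine (fnorm k x)));
    last by rewrite lerDr.
  rewrite ler_wpM2l// (bigD1 (Ordinal (km : (k < m.+1)%N)))//= lerDl.
  exact: sumr_ge0.
apply: (@le_lt_trans _ _ (D * B * (1 - s)^-1)%:E); last exact: ltry.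
apply: lime_le.
  by apply: is_cvg_nneseries => n _ _; rewrite lee_fin continuous_seminorm_ge0.
apply: nearW => n; rewrite sumEFin lee_fin.
apply: (@le_trans _ _ (D * B * \sum_(0 <= i < n) s ^+ i)).
  by rewrite mulr_sumr; apply: ler_sum => i _; rewrite -mulrA [B * _]mulrC.
by rewrite ler_wpM2l ?sum_expr_le// mulr_ge0// ltW.
Qed.

End absolute_convergence.

(** * Assembly for C_t, S and R_t *)

Theorem proposition4p4 (R : realType) (t : R) (ht0 : 0 <= t) (ht1 : t < 1)
    (F : space_kind) (e : exponents R) :
  [/\ in_LX F e (Cop t),
      in_LX F e (@Sop R),
      in_LX F e (Rop t) /\
      Ls_series_abs_cvg F e (fun n x => t%:C ^+ n *: iter n (@Sop R) x) (Rop t),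
      (forall x : fspace F e, Cop t x = Dphi (Rop t x))
    & Ls_series_cvg F e (fun n x => t%:C ^+ n *: Dphi (iter n (@Sop R) x))
        (Cop t)].
Proof.
pose s : R := (1 + t) / 2.
have s_gt0 : 0 < s by rewrite /s; lra.
have s1 : s < 1 by rewrite /s; lra.
have ts : t <= s by rewrite /s; lra.
have tss : t <= s ^+ 2.
  rewrite -subr_ge0 [X in 0 <= X](_ : _ = ((1 - t) / 2) ^+ 2) ?sqr_ge0//.
  by rewrite /s; field.
have s0 := ltW s_gt0.
have RopE' : Rop t = geoconv t%:C by apply/funext => x; exact: RopE.
(* True by conversion: the numerator in [Cop] is the geometric convolution. *)
have CopE' : Cop t = fun x => Dphi (geoconv t%:C x) by [].
have Rd x : geodominated s 1 x (Rop t x).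
  by rewrite RopE'; exact: geodominated_geoconv.
have Cd x : geodominated s 1 x (Cop t x).
  by rewrite CopE'; apply: geodominated_Dphi; rewrite -RopE'.
have Td n x : geodominated s (s ^+ n * 1) x (t%:C ^+ n *: iter n (@Sop R) x).
  by apply: geodominated_iter_Sop => //; exact: geodominated_id.
have Dphi0 : @Dphi R 0 = 0 by apply/funext => n; exact: mul0r.
have DphiZ a x : Dphi (a *: x) = a *: Dphi x :> omega R.
  by rewrite -[a *: x]addr0 Dphi_linear Dphi0 addr0.
have DphiD : {morph @Dphi R : x y / x + y}.
  by move=> x y; rewrite -[x]scale1r Dphi_linear !scale1r.
have DTd n x :
    geodominated s (s ^+ n * 1) x (t%:C ^+ n *: Dphi (iter n (@Sop R) x)).
  by rewrite -DphiZ; exact: geodominated_Dphi.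
have Rl : linear (Rop t) by rewrite RopE'; exact: geoconv_linear.
have Cl : linear (Cop t).
  by move=> a x y; rewrite CopE' geoconv_linear Dphi_linear.
have M0 n : 0 <= s ^+ n * 1 by rewrite mulr1 exprn_ge0.
have RL : in_LX F e (Rop t) := in_LX_dominated s0 s1 Rl ler01 Rd.
have CL : in_LX F e (Cop t) := in_LX_dominated s0 s1 Cl ler01 Cd.
have TL n : in_LX F e (fun x => t%:C ^+ n *: iter n (@Sop R) x).
  apply: (in_LX_dominated s0 s1 _ (M0 n) (Td n)).
  by move=> a x y; rewrite iter_Sop_linear scalerDr !scalerA [_ * a]mulrC.
have DTL n : in_LX F e (fun x => t%:C ^+ n *: Dphi (iter n (@Sop R) x)).
  apply: (in_LX_dominated s0 s1 _ (M0 n) (DTd n)).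
  by move=> a x y; rewrite iter_Sop_linear Dphi_linear scalerDr !scalerA
    [_ * a]mulrC.
split=> //.
- apply: (in_LX_dominated s0 s1 (@Sop_linear R) _
    (fun x => geodominated_Sop s0 x s_gt0)).
  by rewrite invr_ge0.
- split=> //; split.
    apply: (Ls_series_cvg_dominated s0 s1 TL RL ler01) => x N.
    rewrite RopE' geoconv_remainder; apply: geodominated_iter_Sop => //.
    by rewrite -RopE'.
  move=> q x qc; apply: (seminorm_series_lty s_gt0 s1 ler01) => //.
  by move=> n; have [] := TL n.
- by move=> x; rewrite CopE' RopE'.
- apply: (Ls_series_cvg_dominated s0 s1 DTL CL ler01) => x N.
  (* By linearity [Dphi] is pulled out of the partial sum, so that the remainder is [Dphi] of the
     remainder for R_t; [Dphi] preserves domination. *)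
  under eq_bigr do rewrite -DphiZ.
  rewrite -(big_morph _ DphiD Dphi0) -scaleN1r -DphiZ addrC.
  rewrite CopE' -[Dphi (_ *: _)]scale1r -Dphi_linear scale1r addrC scaleN1r.
  rewrite geoconv_remainder; apply: geodominated_Dphi.
  by apply: geodominated_iter_Sop; rewrite // -RopE'.
Qed.
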